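(* Let $\gamma$ be a $\mathcal{C}_+^2$ closed and strictly convex curve in the Euclidean plane $\mathbb{R}^2$ with length $L$ and enclosing a region of area $A$. Let $\rho(\theta)$ be the radius of curvature of $\gamma$ and let $\tilde A$ be the (oriented) area of the domain enclosed by the locus of curvature centers of $\gamma$. Then the following three inequalities hold: $$\text{(i)}\quad L^2\le 4\pi A+\pi|\tilde A|,$$ $$\text{(ii)}\quad \int_0^{2\pi}\rho(\theta)^2\,d\theta\ge\frac{L^2}{\pi}-2A+|\tilde A|,$$ $$\text{(iii)}\quad \max_{\theta\in[0,2\pi]}\rho(\theta)^2\ge\frac{1}{2\pi}\left(\frac{L^2}{\pi}-2A+|\tilde A|\right).$$ Furthermore, (i) and (ii) are improved versions of the inequalities $L^2\le 4\pi(A+|\tilde A|)$ and $\int_0^{2\pi}\rho(\theta)^2\,d\theta\ge\frac{L^2-2\pi A}{\pi}$ respectively, i.e. $4\pi A+\pi|\tilde A|\le 4\pi(A+|\tilde A|)$ and $\frac{L^2}{\pi}-2A+|\tilde A|\ge\frac{L^2-2\pi A}{\pi}$. Equality holds in each of (i), (ii), (iii) if $\gamma$ is a circle. Moreover, if equality holds in (i), or in (ii), or in (iii), then the Minkowski support function of $\gamma$ is of the form $$p(\theta)=a_0+a_1\cos\theta+b_1\sin\theta+a_2\cos 2\theta+b_2\sin 2\theta$$ for some real constants $a_0,a_1,b_1,a_2,b_2$.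
   Context: A $\mathcal{C}_+^2$ closed and strictly convex plane curve is a closed convex curve of class $C^2$ with everywhere positive curvature. It is parametrized by the angle $\theta\in[0,2\pi]$ between the $x$-axis and the outward unit normal vector at the corresponding point. Its Minkowski support function $p(\theta)$ is the $2\pi$-periodic function such that $$\gamma(\theta)=\big(p(\theta)\cos\theta-p'(\theta)\sin\theta,\ p(\theta)\sin\theta+p'(\theta)\cos\theta\big).$$ The radius of curvature is $\rho(\theta)=p(\theta)+p''(\theta)>0$. The length is $L=\int_0^{2\pi}p(\theta)\,d\theta$ and the enclosed area is $A=\frac12\int_0^{2\pi}\big(p(\theta)^2-p'(\theta)^2\big)\,d\theta$. The locus of curvature centers is the curve $$\theta\mapsto\big(-p'(\theta)\sin\theta-p''(\theta)\cos\theta,\ p'(\theta)\cos\theta-p''(\theta)\sin\theta\big),$$ and $\tilde A$ denotes the oriented area of the domain it encloses, given by $\tilde A=\frac12\int_0^{2\pi}\big(p'(\theta)^2-p''(\theta)^2\big)\,d\theta$. *)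

(* Defs.v *)
From Stdlib Require Import Reals Lra.
From Coquelicot Require Import Coquelicot.
Open Scope R_scope.

(** A closed C^2 curve with everywhere positive curvature, parametrized by the
    angle [theta] of its outward unit normal (cos theta, sin theta): its
    velocity is a positive multiple of the unit tangent (- sin theta, cos theta)
    and the factor [r] is ds/dtheta, the inverse of the curvature dtheta/ds.
    As the unit tangent is a smooth function of [theta], the curve is of
    class C^2 in its arc length with positive curvature exactly when [r] is
    continuous and positive.  The normal turns exactly once over a period, so
    the curve is simple, strictly convex and positively oriented. *)
Definition C2plus_closed_curve (gamma : R -> R * R) : Prop :=
  (forall theta, gamma (theta + 2 * PI) = gamma theta) /\
  exists r : R -> R,
    (forall theta, continuous r theta) /\
    (forall theta, 0 < r theta) /\
    (forall theta,
       is_derive (fun t => fst (gamma t)) theta (r theta * - sin theta) /\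
       is_derive (fun t => snd (gamma t)) theta (r theta * cos theta)).

Definition Minkowski_support (gamma : R -> R * R) (p : R -> R) : Prop :=
  (forall theta, p (theta + 2 * PI) = p theta) /\
  (forall theta, ex_derive p theta) /\
  (forall theta, gamma theta =
     (p theta * cos theta - Derive p theta * sin theta,
      p theta * sin theta + Derive p theta * cos theta)).

Definition curvature_radius (p : R -> R) (theta : R) : R :=
  p theta + Derive_n p 2 theta.

Definition curve_length (gamma : R -> R * R) : R :=
  RInt (fun t => sqrt (Derive (fun s => fst (gamma s)) t ^ 2 +
                       Derive (fun s => snd (gamma s)) t ^ 2)) 0 (2 * PI).

(** Area enclosed by a positively oriented simple closed curve, as the line
    integral (1/2) of x dy - y dx. *)
Definition enclosed_area (gamma : R -> R * R) : R :=
  / 2 * RInt (fun t => fst (gamma t) * Derive (fun s => snd (gamma s)) t -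
                       snd (gamma t) * Derive (fun s => fst (gamma s)) t)
             0 (2 * PI).

(** Oriented area of the locus of curvature centers
      (- p' sin - p'' cos, p' cos - p'' sin).
    When [p] is of class C^2 only, this locus need not be differentiable, so
    the area is given by the formula in which no third derivative occurs; for
    [p] of class C^3 it is the line integral (1/2) of x dy - y dx. *)
Definition evolute_area (p : R -> R) : R :=
  / 2 * RInt (fun t => Derive p t ^ 2 - Derive_n p 2 t ^ 2) 0 (2 * PI).

Definition is_max_on (f : R -> R) (a b M : R) : Prop :=
  (exists t, a <= t <= b /\ f t = M) /\
  (forall t, a <= t <= b -> f t <= M).

Definition is_circle (gamma : R -> R * R) : Prop :=
  exists c1 c2 r : R, 0 < r /\
    forall P : R * R,
      (exists theta, gamma theta = P) <->
      (fst P - c1) ^ 2 + (snd P - c2) ^ 2 = r ^ 2.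

(* Main.v *)
(** Differentiating [p = <gamma, N>] gives [p'' = r - p], where [r = ds/dtheta], so
    [rho = r].  The deficits in (i) and (ii) are then both positive multiples of
    [int (p''^2 + 5 p p'' + 4 p^2) - 2 L^2 / PI], which in terms of the Fourier
    coefficients is the sum of [(n^2 - 1) (n^2 - 4)] times the energy of the
    mode [n >= 1]; (iii) follows from (ii), and the equality cases
    force [p] to have modes of order at most 2.

    Completeness of the Fourier basis is avoided.  Write [p = m + w], where [m]
    is the Fourier sum of order 2.  The residual satisfies
    [- 2 PI w(x) = int K(t) w''(x + t) dt] for the projection [K] of
    [(t - PI)^2 / 2] off the modes of order at most 2, and by Cauchy-Schwarz
    [int w^2 <= k int w''^2] with [k = PI^4/45 - 17/8].  As [PI < 3.149],
    [k < 1/16], whereas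
    [w''^2 + 5 w w'' + 4 w^2 = 10 (w''/4 + w)^2 + 3/8 (w''^2 - 16 w^2)]. *)

Require Import Defs.
From Stdlib Require Import Reals Lra.
From Coquelicot Require Import Coquelicot.
Open Scope R_scope.

(** * Continuity of real functions *)

Definition cts (f : R -> R) : Prop := forall t, continuous f t.

Lemma cts_const (c : R) : cts (fun _ => c).
Proof. intros t; apply continuous_const. Qed.

Lemma cts_id : cts (fun t => t).
Proof. intros t; apply continuous_id. Qed.

Lemma cts_plus (f g : R -> R) : cts f -> cts g -> cts (fun t => f t + g t).
Proof. intros hf hg t; exact (continuous_plus f g t (hf t) (hg t)). Qed.

Lemma cts_opp (f : R -> R) : cts f -> cts (fun t => - f t).
Proof. intros hf t; exact (continuous_opp f t (hf t)). Qed.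

Lemma cts_minus (f g : R -> R) : cts f -> cts g -> cts (fun t => f t - g t).
Proof. intros hf hg t; exact (continuous_minus f g t (hf t) (hg t)). Qed.

Lemma cts_mult (f g : R -> R) : cts f -> cts g -> cts (fun t => f t * g t).
Proof. intros hf hg t; exact (continuous_mult f g t (hf t) (hg t)). Qed.

Lemma cts_pow (f : R -> R) (n : nat) : cts f -> cts (fun t => f t ^ n).
Proof.
  intros hf; induction n as [|n IH]; simpl.
  - apply cts_const.
  - now apply cts_mult.
Qed.

Lemma cts_comp (f g : R -> R) : cts f -> cts g -> cts (fun t => g (f t)).
Proof. intros hf hg t; exact (continuous_comp f g t (hf t) (hg (f t))). Qed.

Lemma cts_cos : cts cos.
Proof. intros t; apply continuous_cos. Qed.

Lemma cts_sin : cts sin.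
Proof. intros t; apply continuous_sin. Qed.

Lemma cts_derive (f df : R -> R) : (forall t, is_derive f t (df t)) -> cts f.
Proof. intros h t; apply (ex_derive_continuous f); exists (df t); apply h. Qed.

Lemma cts_ext (f g : R -> R) : (forall t, f t = g t) -> cts f -> cts g.
Proof. intros e h t; apply continuous_ext with f; [exact e | apply h]. Qed.

Create HintDb cts.

Ltac cts :=
  lazymatch goal with
  | h : cts ?f |- cts ?f => exact h
  | |- cts (fun _ => ?c) => apply cts_const
  | |- cts (fun t => t) => apply cts_id
  | |- cts (fun t => @?f t + @?g t) => apply (cts_plus f g); cts
  | |- cts (fun t => @?f t - @?g t) => apply (cts_minus f g); cts
  | |- cts (fun t => @?f t * @?g t) => apply (cts_mult f g); cts
  | |- cts (fun t => @?f t / @?g t) => unfold Rdiv; cts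
  | |- cts (fun t => - @?f t) => apply (cts_opp f); cts
  | |- cts (fun t => @?f t ^ ?n) => apply (cts_pow f n); cts
  | |- cts cos => apply cts_cos
  | |- cts sin => apply cts_sin
  | |- cts (fun t => ?f (@?g t)) =>
      lazymatch g with
      | fun t => t => change (cts f); cts
      | _ => apply (cts_comp g f); cts
      end
  | |- _ => auto with cts
  end.

(** * Integrals over one period *)

#[local] Notation per_int f := (RInt f 0 (2 * PI) : R).

Lemma ex_RInt_cts (f : R -> R) (a b : R) : cts f -> ex_RInt f a b.
Proof. intros h; apply (@ex_RInt_continuous R_CompleteNormedModule); intros; apply h. Qed.

Lemma per_int_ext (f g : R -> R) : (forall t, f t = g t) -> per_int f = per_int g.
Proof. intros e; apply RInt_ext; intros; apply e. Qed.

Lemma per_int_lin (a b : R) (f g : R -> R) :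
  cts f -> cts g ->
  per_int (fun t => a * f t + b * g t) = a * per_int f + b * per_int g.
Proof.
  intros hf hg.
  apply is_RInt_unique.
  apply (is_RInt_plus (V := R_NormedModule) (fun t => a * f t) (fun t => b * g t)).
  - apply (is_RInt_scal (V := R_NormedModule) f), (RInt_correct (V := R_CompleteNormedModule)).
    now apply ex_RInt_cts.
  - apply (is_RInt_scal (V := R_NormedModule) g), (RInt_correct (V := R_CompleteNormedModule)).
    now apply ex_RInt_cts.
Qed.

Lemma per_int_const (c : R) : per_int (fun _ => c) = 2 * PI * c.
Proof. rewrite RInt_const; unfold scal; simpl; unfold mult; simpl; ring. Qed.

Lemma per_int_ge_0 (f : R -> R) : cts f -> (forall t, 0 <= f t) -> 0 <= per_int f.
Proof.
  intros hf h; pose proof PI_RGT_0; apply RInt_ge_0; [lra | now apply ex_RInt_cts | auto].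
Qed.

Lemma per_int_le (f g : R -> R) :
  cts f -> cts g -> (forall t, 0 <= t <= 2 * PI -> f t <= g t) -> per_int f <= per_int g.
Proof.
  intros hf hg h; pose proof PI_RGT_0.
  apply RInt_le; [lra | now apply ex_RInt_cts | now apply ex_RInt_cts | ].
  intros; apply h; lra.
Qed.

Lemma per_int_derive (F f : R -> R) :
  (forall t, is_derive F t (f t)) -> cts f -> per_int f = F (2 * PI) - F 0.
Proof.
  intros hF hf; apply is_RInt_unique.
  apply (is_RInt_derive (V := R_CompleteNormedModule) F f); intros; auto.
Qed.

(** Splitting the integral over [[0, x + 2 * PI]] at [x] and at [2 * PI] leaves the end pieces
    [[0, x]] and [[2 * PI, x + 2 * PI]], on which periodicity makes the integrals equal. *)
Lemma per_int_shift (f : R -> R) (x : R) :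
  cts f -> (forall t, f (t + 2 * PI) = f t) ->
  per_int (fun t => f (x + t)) = per_int f.
Proof.
  intros hf per.
  assert (E : forall a b u : R, RInt (fun t => f (u + t)) a b = RInt f (u + a) (u + b)).
  { intros a b u.
    replace (u + a) with (1 * a + u) by ring; replace (u + b) with (1 * b + u) by ring.
    rewrite <- (RInt_comp_lin (V := R_CompleteNormedModule) f 1 u a b) by now apply ex_RInt_cts.
    apply RInt_ext; intros t _; unfold scal; simpl; unfold mult; simpl.
    rewrite Rmult_1_l; f_equal; ring. }
  rewrite E, Rplus_0_r.
  pose proof (RInt_Chasles (V := R_CompleteNormedModule) f 0 x (x + 2 * PI)
    (ex_RInt_cts _ _ _ hf) (ex_RInt_cts _ _ _ hf)) as C1.
  pose proof (RInt_Chasles (V := R_CompleteNormedModule) f 0 (2 * PI) (x + 2 * PI)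
    (ex_RInt_cts _ _ _ hf) (ex_RInt_cts _ _ _ hf)) as C2.
  assert (C3 : RInt f (2 * PI) (x + 2 * PI) = RInt f 0 x).
  { replace (RInt f (2 * PI) (x + 2 * PI)) with (RInt f (2 * PI + 0) (2 * PI + x))
      by (f_equal; ring).
    rewrite <- E; apply RInt_ext; intros t _; rewrite Rplus_comm; apply per. }
  unfold plus in C1, C2; simpl in C1, C2; lra.
Qed.

(** * Trigonometric polynomials of order at most 2 and their moments *)

Definition trig2 (a0 a1 b1 a2 b2 t : R) : R :=
  a0 + a1 * cos t + b1 * sin t + a2 * cos (2 * t) + b2 * sin (2 * t).

Lemma cts_trig2 (a0 a1 b1 a2 b2 : R) : cts (trig2 a0 a1 b1 a2 b2).
Proof. unfold trig2; cts. Qed.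

#[local] Hint Resolve cts_trig2 : cts.

Lemma per_int_mul_trig2 (g : R -> R) (a0 a1 b1 a2 b2 : R) :
  cts g ->
  per_int (fun t => g t * trig2 a0 a1 b1 a2 b2 t) =
  a0 * per_int g + a1 * per_int (fun t => g t * cos t)
  + b1 * per_int (fun t => g t * sin t)
  + a2 * per_int (fun t => g t * cos (2 * t))
  + b2 * per_int (fun t => g t * sin (2 * t)).
Proof.
  intros hg.
  (* The factors [1] here, and [1] or [-1] below, give each sum the shape [a * f t + b * g t] that
     [per_int_lin] expects. *)
  rewrite (per_int_ext _ (fun t => 1 * (a0 * g t + a1 * (g t * cos t)) +
    1 * (b1 * (g t * sin t) + 1 * (a2 * (g t * cos (2 * t)) + b2 * (g t * sin (2 * t))))))
    by (intros; unfold trig2; ring).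
  rewrite per_int_lin, per_int_lin, per_int_lin, per_int_lin by cts.
  ring.
Qed.

(** Oriented to eliminate squares of the sine, so that [ring] and [field] can decide trigonometric
    identities modulo this relation. *)
Lemma sin_pow2 (t : R) : sin t ^ 2 = 1 - cos t ^ 2.
Proof. pose proof (sin2_cos2 t) as h; unfold Rsqr in h; lra. Qed.

(* [F] is an antiderivative written as a polynomial in [t], [sin t], [cos t]. *)
Ltac int_by F :=
  rewrite (per_int_derive F);
  [ rewrite sin_2PI, cos_2PI, sin_0, cos_0; try field
  | intros t; auto_derive; trivial;
    rewrite ?cos_2a_cos, ?sin_2a;
    pose proof (sin_pow2 t) as hsc; generalize dependent (sin t);
    intros s hsc; generalize dependent (cos t); intros c hsc; field [hsc]
  | cts ].

Lemma trig2_moments (a0 a1 b1 a2 b2 : R) :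
  per_int (trig2 a0 a1 b1 a2 b2) = 2 * PI * a0 /\
  per_int (fun t => trig2 a0 a1 b1 a2 b2 t * cos t) = PI * a1 /\
  per_int (fun t => trig2 a0 a1 b1 a2 b2 t * sin t) = PI * b1 /\
  per_int (fun t => trig2 a0 a1 b1 a2 b2 t * cos (2 * t)) = PI * a2 /\
  per_int (fun t => trig2 a0 a1 b1 a2 b2 t * sin (2 * t)) = PI * b2.
Proof.
  unfold trig2; repeat split.
  - int_by (fun t => a0 * t + a1 * sin t - b1 * cos t + a2 * (sin t * cos t)
              + b2 * sin t ^ 2).
  - int_by (fun t => a0 * sin t + a1 * ((t + sin t * cos t) / 2) + b1 * (sin t ^ 2 / 2)
              + a2 * (sin t - 2 * sin t ^ 3 / 3) + b2 * (- 2 * cos t ^ 3 / 3)).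
  - int_by (fun t => a0 * - cos t + a1 * (sin t ^ 2 / 2) + b1 * ((t - sin t * cos t) / 2)
              + a2 * (cos t - 2 * cos t ^ 3 / 3) + b2 * (2 * sin t ^ 3 / 3)).
  - int_by (fun t => a0 * (sin t * cos t) + a1 * (sin t - 2 * sin t ^ 3 / 3)
              + b1 * (cos t - 2 * cos t ^ 3 / 3)
              + a2 * (t / 2 + sin t * cos t * (2 * cos t ^ 2 - 1) / 2)
              + b2 * (sin t ^ 2 * cos t ^ 2)).
  - int_by (fun t => a0 * sin t ^ 2 + a1 * (- 2 * cos t ^ 3 / 3) + b1 * (2 * sin t ^ 3 / 3)
              + a2 * (sin t ^ 2 * cos t ^ 2)
              + b2 * (t / 2 - sin t * cos t * (2 * cos t ^ 2 - 1) / 2)).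
Qed.

Lemma per_int_trig2_mul (a0 a1 b1 a2 b2 a0' a1' b1' a2' b2' : R) :
  per_int (fun t => trig2 a0 a1 b1 a2 b2 t * trig2 a0' a1' b1' a2' b2' t) =
  2 * PI * (a0 * a0') + PI * (a1 * a1' + b1 * b1' + a2 * a2' + b2 * b2').
Proof.
  rewrite per_int_mul_trig2 by apply cts_trig2.
  destruct (trig2_moments a0 a1 b1 a2 b2) as (-> & -> & -> & -> & ->); ring.
Qed.

(** * A numerical bound on [PI] and the kernel of the residual estimate *)

(** Otherwise 3149/2000 would be at most [PI / 2] and have a nonnegative cosine, whereas the Taylor
    polynomial of degree 8, an upper bound of the cosine, is negative there. The later use requires
    [PI ^ 4 < 45 * 35 / 16], that is [PI] below about 3.1498. *)
Lemma PI_upper_bound : PI < 3149 / 1000.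
Proof.
  apply Rnot_le_lt; intros h.
  assert (h0 : 0 <= cos (3149 / 2000)) by (apply cos_ge_0; lra).
  destruct (pre_cos_bound (3149 / 2000) 1) as [_ h1]; try lra.
  unfold cos_approx, cos_term in h1; cbn [sum_f_R0 Nat.mul Nat.add] in h1.
  rewrite ?fact_simpl, ?mult_INR in h1; simpl in h1; lra.
Qed.

(* The part of [(t - PI)^2 / 2] orthogonal to the trigonometric polynomials of
   degree at most 2: that function has Fourier series
   [PI^2/6 + sum 2 cos (n t) / n^2]. *)
Definition kernel (t : R) : R :=
  (t - PI) ^ 2 / 2 - trig2 (PI ^ 2 / 6) 2 0 (/ 2) 0 t.

Lemma cts_kernel : cts kernel.
Proof. unfold kernel; cts. Qed.

#[local] Hint Resolve cts_kernel : cts.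

(** By Parseval the value is [4 * PI] times the sum of [/ n ^ 4] over [n >= 3], which is
    [4 * PI * (PI ^ 4 / 90 - 1 - / 16)]; an explicit antiderivative replaces the series. *)
Lemma kernel_norm :
  per_int (fun t => kernel t ^ 2) = 2 * PI ^ 5 / 45 - 17 * PI / 4.
Proof.
  unfold kernel, trig2.
  (* With [q = (t - PI) ^ 2 / 2 - PI ^ 2 / 6], the lines integrate in order the terms of the
     expanded square: [q ^ 2], [- 4 * q * cos t], [- q * cos (2 * t)] (two lines), [4 * cos t ^ 2],
     [cos (2 * t) ^ 2 / 4] and [2 * cos t * cos (2 * t)]. *)
  int_by (fun t =>
    (t - PI) ^ 5 / 20 - PI ^ 2 / 18 * (t - PI) ^ 3 + PI ^ 4 / 36 * t
    - 4 * (((t - PI) ^ 2 / 2 - PI ^ 2 / 6) * sin t + (t - PI) * cos t - sin t)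
    - (((t - PI) ^ 2 / 2 - PI ^ 2 / 6) * (sin t * cos t)
       + (t - PI) * (2 * cos t ^ 2 - 1) / 4 - sin t * cos t / 4)
    + 2 * (t + sin t * cos t)
    + (t / 2 + sin t * cos t * (2 * cos t ^ 2 - 1) / 2) / 4
    + 2 * (sin t - 2 * sin t ^ 3 / 3)).
Qed.

(** * Estimates for periodic functions without modes of order at most 2 *)

Lemma Derive_fun (f df : R -> R) :
  (forall t, is_derive f t (df t)) -> forall t, Derive (fun u : R => f u) t = df t.
Proof. intros h t; apply is_derive_unique, h. Qed.

Lemma is_derive_periodic (f df : R -> R) (c : R) :
  (forall t, is_derive f t (df t)) -> (forall t, f (t + c) = f t) ->
  forall t, df (t + c) = df t.
Proof.
  intros d per t.
  rewrite <- (is_derive_unique _ _ _ (d t)); symmetry; apply is_derive_unique.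
  apply is_derive_ext with (fun u : R => f (u + c)); [exact per |].
  auto_derive; [exists (df (t + c)); apply d | rewrite (Derive_fun _ _ d); ring].
Qed.

(** Two integrations by parts. The parabola takes the same value at both ends, so the [w1] boundary
    terms cancel; its slope [t - PI] goes from [- PI] to [PI], which produces [2 * PI * w x]. *)
Lemma per_int_kernel (w w1 w2 : R -> R) (x : R) :
  (forall t, is_derive w t (w1 t)) -> (forall t, is_derive w1 t (w2 t)) -> cts w2 ->
  (forall t, w (t + 2 * PI) = w t) ->
  per_int (fun t => w2 (x + t) * ((t - PI) ^ 2 / 2)) = per_int w - 2 * PI * w x.
Proof.
  intros d1 d2 c2 q1.
  pose proof (is_derive_periodic _ _ _ d1 q1) as q2.
  pose proof (cts_derive _ _ d1) as c0.
  assert (E : per_int (fun t => 1 * (w2 (x + t) * ((t - PI) ^ 2 / 2)) + -1 * w (x + t)) =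
              - (2 * PI * w x)).
  { rewrite (per_int_derive
      (fun t => w1 (x + t) * ((t - PI) ^ 2 / 2) - w (x + t) * (t - PI))).
    - rewrite q1, q2, Rplus_0_r; field.
    - intros t; auto_derive.
      + repeat split; [exists (w2 (x + t)); apply d2 | exists (w1 (x + t)); apply d1].
      + rewrite (Derive_fun _ _ d1), (Derive_fun _ _ d2).
        field.
    - cts. }
  rewrite per_int_lin in E by cts.
  rewrite (per_int_shift w x c0 q1) in E; lra.
Qed.

Lemma trig2_minus (a0 a1 b1 a2 b2 t x : R) :
  trig2 a0 a1 b1 a2 b2 (t - x) =
  trig2 a0 (a1 * cos x - b1 * sin x) (a1 * sin x + b1 * cos x)
    (a2 * cos (2 * x) - b2 * sin (2 * x)) (a2 * sin (2 * x) + b2 * cos (2 * x)) t.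
Proof.
  unfold trig2.
  replace (2 * (t - x)) with (2 * t - 2 * x) by ring.
  rewrite !cos_minus, !sin_minus; ring.
Qed.

Lemma trig2_periodic (a0 a1 b1 a2 b2 t : R) :
  trig2 a0 a1 b1 a2 b2 (t + 2 * PI) = trig2 a0 a1 b1 a2 b2 t.
Proof.
  unfold trig2; rewrite !cos_2a_cos, !sin_2a, cos_plus, sin_plus, cos_2PI, sin_2PI; ring.
Qed.

(** A translation of [g] can be moved onto the trigonometric polynomial, and polynomials of order at
    most 2 are stable under translation. *)
Lemma per_int_mul_trig2_shift (g : R -> R) (x : R) :
  cts g -> (forall t, g (t + 2 * PI) = g t) ->
  (forall a0 a1 b1 a2 b2, per_int (fun t => g t * trig2 a0 a1 b1 a2 b2 t) = 0) ->
  forall a0 a1 b1 a2 b2, per_int (fun t => g (x + t) * trig2 a0 a1 b1 a2 b2 t) = 0.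
Proof.
  intros hg per orth a0 a1 b1 a2 b2.
  rewrite (per_int_ext _ (fun t => (fun u => g u * trig2 a0 a1 b1 a2 b2 (u - x)) (x + t))).
  - rewrite (per_int_shift (fun u => g u * trig2 a0 a1 b1 a2 b2 (u - x))).
    + rewrite (per_int_ext _ _ (fun t => f_equal (Rmult (g t)) (trig2_minus a0 a1 b1 a2 b2 t x))).
      apply orth.
    + pose proof (cts_trig2 a0 a1 b1 a2 b2); cts.
    + intros t; rewrite per, !trig2_minus, trig2_periodic; reflexivity.
  - intros t; simpl; do 2 f_equal; ring.
Qed.

(** Cauchy-Schwarz in algebraic form. The two test vectors show that [c * (a * c - b ^ 2)] and
    [a * (a * c - b ^ 2)] are nonnegative; adding them settles the case [a + c > 0]. If [a] and [c]
    vanish, the form changes sign unless [b = 0]. *)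
Lemma quadratic_form_discriminant (a b c : R) :
  (forall l m, 0 <= m ^ 2 * a + 2 * l * m * b + l ^ 2 * c) -> b ^ 2 <= a * c.
Proof.
  intros P.
  pose proof (P 0 1) as ha; pose proof (P 1 0) as hc; ring_simplify in ha; ring_simplify in hc.
  pose proof (P (- b) c) as h1; pose proof (P a (- b)) as h2.
  destruct (Req_dec (a + c) 0) as [z | nz].
  - assert (a = 0) by lra; assert (c = 0) by lra; subst.
    pose proof (P 1 (- b)); nra.
  - apply Rmult_le_reg_l with (a + c); [lra | nra].
Qed.

Lemma residual_sup_bound (w w1 w2 : R -> R) (x : R) :
  (forall t, is_derive w t (w1 t)) -> (forall t, is_derive w1 t (w2 t)) -> cts w2 ->
  (forall t, w (t + 2 * PI) = w t) ->
  per_int w = 0 ->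
  (forall a0 a1 b1 a2 b2, per_int (fun t => w2 t * trig2 a0 a1 b1 a2 b2 t) = 0) ->
  4 * PI ^ 2 * w x ^ 2 <= (2 * PI ^ 5 / 45 - 17 * PI / 4) * per_int (fun t => w2 t ^ 2).
Proof.
  intros d1 d2 c2 q0 m0 orth.
  pose proof (is_derive_periodic _ _ _ d1 q0) as q1.
  pose proof (is_derive_periodic _ _ _ d2 q1) as q2.
  set (C := 2 * PI ^ 5 / 45 - 17 * PI / 4); set (X := per_int (fun t => w2 t ^ 2)).
  (* Projecting the parabola to [kernel] does not change the pairing, since translates of [w2] are
     orthogonal to the part removed. *)
  assert (K : per_int (fun t => w2 (x + t) * kernel t) = - (2 * PI * w x)).
  { rewrite (per_int_ext _ (fun t => 1 * (w2 (x + t) * ((t - PI) ^ 2 / 2)) +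
      -1 * (w2 (x + t) * trig2 (PI ^ 2 / 6) 2 0 (/ 2) 0 t)))
      by (intros; unfold kernel; ring).
    rewrite per_int_lin by cts.
    rewrite (per_int_kernel w w1 w2 x d1 d2 c2 q0).
    rewrite (per_int_mul_trig2_shift w2 x c2 q2 orth); rewrite m0; ring. }
  assert (S : per_int (fun t => w2 (x + t) ^ 2) = X).
  { apply (per_int_shift (fun t => w2 t ^ 2)); [cts | intros; now rewrite q2]. }
  assert (P : forall l m, 0 <= m ^ 2 * X + 2 * l * m * - (2 * PI * w x) + l ^ 2 * C).
  { intros l m.
    replace (m ^ 2 * X + 2 * l * m * - (2 * PI * w x) + l ^ 2 * C) with
      (per_int (fun t => (m * w2 (x + t) + l * kernel t) ^ 2)).
    - apply per_int_ge_0; [cts | intros; apply pow2_ge_0].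
    - rewrite (per_int_ext _ (fun t => 1 * (m ^ 2 * (w2 (x + t) ^ 2) +
        2 * l * m * (w2 (x + t) * kernel t)) + l ^ 2 * (kernel t ^ 2)))
        by (intros; ring).
      rewrite !per_int_lin by cts.
      rewrite S, K, kernel_norm; fold C; ring. }
  pose proof (quadratic_form_discriminant _ _ _ P); lra.
Qed.

(** The sharp constant for modes of order at least 3 is 1/81. A bound strictly below 1/16 suffices,
    and its strictness decides the equality case. *)
Lemma residual_norm_bound (w w1 w2 : R -> R) :
  (forall t, is_derive w t (w1 t)) -> (forall t, is_derive w1 t (w2 t)) -> cts w2 ->
  (forall t, w (t + 2 * PI) = w t) ->
  per_int w = 0 ->
  (forall a0 a1 b1 a2 b2, per_int (fun t => w2 t * trig2 a0 a1 b1 a2 b2 t) = 0) ->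
  exists k, k < / 16 /\ per_int (fun t => w t ^ 2) <= k * per_int (fun t => w2 t ^ 2).
Proof.
  intros d1 d2 c2 q0 m0 orth.
  pose proof (cts_derive _ _ d1) as c0.
  pose proof PI_RGT_0; pose proof PI_upper_bound.
  (* Integrating the pointwise bound over a period divides [2 * PI ^ 5 / 45 - 17 * PI / 4] by
     [2 * PI]. *)
  exists (PI ^ 4 / 45 - 17 / 8); split.
  - assert (h2 : PI ^ 2 <= (3149 / 1000) ^ 2) by nra.
    replace (PI ^ 4) with (PI ^ 2 * PI ^ 2) by ring.
    assert (0 <= PI ^ 2) by nra.
    assert (PI ^ 2 * PI ^ 2 <= (3149 / 1000) ^ 2 * (3149 / 1000) ^ 2)
      by (apply Rmult_le_compat; assumption).
    lra.
  - set (X := per_int (fun t => w2 t ^ 2)).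
    apply Rle_trans with (per_int (fun _ => (PI ^ 4 / 45 - 17 / 8) * X / (2 * PI))).
    + apply per_int_le; [cts | cts | intros t _].
      pose proof (residual_sup_bound w w1 w2 t d1 d2 c2 q0 m0 orth) as h; fold X in h.
      apply Rmult_le_reg_l with (4 * PI ^ 2); [nra |].
      apply Rle_trans with (1 := h), Req_le; field; lra.
    + rewrite per_int_const; apply Req_le; field; lra.
Qed.

Lemma wirtinger_residual (w w1 w2 : R -> R) :
  (forall t, is_derive w t (w1 t)) -> (forall t, is_derive w1 t (w2 t)) -> cts w2 ->
  (forall t, w (t + 2 * PI) = w t) ->
  per_int w = 0 ->
  (forall a0 a1 b1 a2 b2, per_int (fun t => w2 t * trig2 a0 a1 b1 a2 b2 t) = 0) ->
  0 <= per_int (fun t => w2 t ^ 2) + per_int (fun t => w t * w2 t) /\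
  0 <= per_int (fun t => w2 t ^ 2) + 5 * per_int (fun t => w t * w2 t)
       + 4 * per_int (fun t => w t ^ 2) /\
  (per_int (fun t => w2 t ^ 2) + 5 * per_int (fun t => w t * w2 t)
     + 4 * per_int (fun t => w t ^ 2) = 0 -> forall t, w t = 0).
Proof.
  intros d1 d2 c2 q0 m0 orth.
  pose proof (cts_derive _ _ d1) as c0.
  destruct (residual_norm_bound w w1 w2 d1 d2 c2 q0 m0 orth) as (k & hk & h).
  pose proof (fun x => residual_sup_bound w w1 w2 x d1 d2 c2 q0 m0 orth) as hs.
  assert (S : forall l, 0 <= l ^ 2 * per_int (fun t => w2 t ^ 2)
    + 2 * l * per_int (fun t => w t * w2 t) + per_int (fun t => w t ^ 2)).
  { intros l.
    replace (l ^ 2 * per_int (fun t => w2 t ^ 2) + 2 * l * per_int (fun t => w t * w2 t)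
      + per_int (fun t => w t ^ 2)) with (per_int (fun t => (l * w2 t + w t) ^ 2)).
    - apply per_int_ge_0; [cts | intros; apply pow2_ge_0].
    - rewrite (per_int_ext _ (fun t => 1 * (l ^ 2 * (w2 t ^ 2)
        + 2 * l * (w t * w2 t)) + 1 * (w t ^ 2))) by (intros; ring).
      rewrite !per_int_lin by cts; ring. }
  assert (X0 : 0 <= per_int (fun t => w2 t ^ 2))
    by (apply per_int_ge_0; [cts | intros; apply pow2_ge_0]).
  set (X := per_int (fun t => w2 t ^ 2)) in *.
  set (Y := per_int (fun t => w t ^ 2)) in *.
  set (Z := per_int (fun t => w t * w2 t)) in *.
  (* With [Y <= X / 16], the choice [/ 2] gives [Z >= - 5 / 16 * X], hence the first claim. Ten
     times the choice [/ 4] gives [X + 5 * Z + 4 * Y >= 6 * (X / 16 - Y)], hence the second. *)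
  pose proof (S (/ 2)) as S1; pose proof (S (/ 4)) as S2.
  assert (hkX : k * X <= / 16 * X) by (apply Rmult_le_compat_r; lra).
  repeat split.
  - lra.
  - lra.
  - intros e x.
    (* As [k < / 16], equality forces [X = 0], and the pointwise bound then makes [w] vanish
       everywhere. *)
    assert (kX : (/ 16 - k) * X <= 0) by lra.
    assert (X = 0) as X_0.
    { apply Rle_antisym; [| assumption].
      apply Rmult_le_reg_l with (/ 16 - k); lra. }
    specialize (hs x); fold X in hs; rewrite X_0 in hs.
    pose proof PI_RGT_0.
    assert (hx : w x ^ 2 <= 0) by (apply Rmult_le_reg_l with (4 * PI ^ 2); nra).
    nra.
Qed.

(** * The second-order Wirtinger inequality for periodic functions *)

(** The difference of the integrands is the derivative of the periodic function
    [p1 * f - p * f1]. *)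
Lemma per_int_parts (p p1 p2 f f1 f2 : R -> R) :
  (forall t, is_derive p t (p1 t)) -> (forall t, is_derive p1 t (p2 t)) -> cts p2 ->
  (forall t, is_derive f t (f1 t)) -> (forall t, is_derive f1 t (f2 t)) -> cts f2 ->
  (forall t, p (t + 2 * PI) = p t) -> (forall t, f (t + 2 * PI) = f t) ->
  per_int (fun t => p2 t * f t) = per_int (fun t => p t * f2 t).
Proof.
  intros d1 d2 c2 e1 e2 g2 q0 r0.
  pose proof (is_derive_periodic _ _ _ d1 q0) as q1.
  pose proof (is_derive_periodic _ _ _ e1 r0) as r1.
  pose proof (cts_derive _ _ d1) as c0; pose proof (cts_derive _ _ e1) as g0.
  assert (E : per_int (fun t => 1 * (p2 t * f t) + -1 * (p t * f2 t)) = 0).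
  { rewrite (per_int_derive (fun t => p1 t * f t - p t * f1 t)).
    - rewrite <- (q0 0), <- (q1 0), <- (r0 0), <- (r1 0), Rplus_0_l; ring.
    - intros t; auto_derive.
      + repeat split; [exists (p2 t); apply d2 | exists (f1 t); apply e1
                      | exists (p1 t); apply d1 | exists (f2 t); apply e2].
      + rewrite (Derive_fun _ _ d1),
          (Derive_fun _ _ d2),
          (Derive_fun _ _ e1),
          (Derive_fun _ _ e2).
        ring.
    - cts. }
  rewrite per_int_lin in E by cts; lra.
Qed.

Lemma is_derive_trig2 (a0 a1 b1 a2 b2 t : R) :
  is_derive (trig2 a0 a1 b1 a2 b2) t (trig2 0 b1 (- a1) (2 * b2) (- 2 * a2) t).
Proof. unfold trig2; auto_derive; trivial; ring. Qed.

(** Orthogonality decouples [m] and [w]. In the second form the modes 1 and 2 have weights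
    [1 - 5 + 4 = 0] and [16 - 20 + 4 = 0], and the constant mode gives exactly the left-hand side,
    so that only the residual form remains. In the first form these modes have weights 0 and 12. *)
Lemma second_order_wirtinger (p p1 p2 : R -> R) :
  (forall t, is_derive p t (p1 t)) -> (forall t, is_derive p1 t (p2 t)) -> cts p2 ->
  (forall t, p (t + 2 * PI) = p t) ->
  0 <= per_int (fun t => p2 t ^ 2) + per_int (fun t => p t * p2 t) /\
  (per_int p) ^ 2 * 2 / PI <= per_int (fun t => p2 t ^ 2)
    + 5 * per_int (fun t => p t * p2 t) + 4 * per_int (fun t => p t ^ 2) /\
  (per_int (fun t => p2 t ^ 2) + 5 * per_int (fun t => p t * p2 t)
     + 4 * per_int (fun t => p t ^ 2) = (per_int p) ^ 2 * 2 / PI ->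
   exists a0 a1 b1 a2 b2, forall t, p t = trig2 a0 a1 b1 a2 b2 t).
Proof.
  intros d1 d2 c2 q0.
  pose proof (cts_derive _ _ d1) as c0; pose proof PI_RGT_0 as hpi.
  set (a0 := per_int p / (2 * PI)).
  set (a1 := per_int (fun t => p t * cos t) / PI).
  set (b1 := per_int (fun t => p t * sin t) / PI).
  set (a2 := per_int (fun t => p t * cos (2 * t)) / PI).
  set (b2 := per_int (fun t => p t * sin (2 * t)) / PI).
  set (m := trig2 a0 a1 b1 a2 b2).
  set (m1 := trig2 0 b1 (- a1) (2 * b2) (- 2 * a2)).
  set (m2 := trig2 0 (- a1) (- b1) (- 4 * a2) (- 4 * b2)).
  assert (cm : cts m) by apply cts_trig2.
  assert (cm2 : cts m2) by apply cts_trig2.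
  set (w := fun t => p t - m t); set (w1 := fun t => p1 t - m1 t).
  set (w2 := fun t => p2 t - m2 t).
  assert (e1 : forall t, is_derive m t (m1 t)) by (intros; apply is_derive_trig2).
  assert (e2 : forall t, is_derive m1 t (m2 t)).
  { intros; unfold m1, m2.
    replace (- 4 * a2) with (2 * (-2 * a2)) by ring.
    replace (- 4 * b2) with (-2 * (2 * b2)) by ring.
    apply is_derive_trig2. }
  assert (f1 : forall t, is_derive w t (w1 t)).
  { intros; exact (is_derive_minus p m t _ _ (d1 t) (e1 t)). }
  assert (f2 : forall t, is_derive w1 t (w2 t)).
  { intros; exact (is_derive_minus p1 m1 t _ _ (d2 t) (e2 t)). }
  assert (cw : cts w) by (unfold w; cts).
  assert (cw2 : cts w2) by (unfold w2; cts).
  assert (r0 : forall t, w (t + 2 * PI) = w t)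
    by (intros; unfold w, m; now rewrite q0, trig2_periodic).
  assert (O : forall x0 x1 y1 x2 y2,
    per_int (fun t => w t * trig2 x0 x1 y1 x2 y2 t) = 0).
  { intros.
    pose proof (cts_trig2 x0 x1 y1 x2 y2).
    rewrite (per_int_ext _ (fun t => 1 * (p t * trig2 x0 x1 y1 x2 y2 t)
      + -1 * (m t * trig2 x0 x1 y1 x2 y2 t))) by (intros; unfold w; ring).
    rewrite per_int_lin by cts.
    unfold m; rewrite per_int_trig2_mul, per_int_mul_trig2 by assumption.
    unfold a0, a1, b1, a2, b2; field; lra. }
  (* Orthogonality passes from [w] to [w2] by parts, because second derivatives of such polynomials
     are again of order at most 2. *)
  assert (O2 : forall x0 x1 y1 x2 y2,
    per_int (fun t => w2 t * trig2 x0 x1 y1 x2 y2 t) = 0).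
  { intros.
    rewrite (per_int_parts w w1 w2 (trig2 x0 x1 y1 x2 y2)
      (trig2 0 y1 (- x1) (2 * y2) (- 2 * x2))
      (trig2 0 (- x1) (- y1) (2 * (- 2 * x2)) (- 2 * (2 * y2)))); trivial.
    - intros; apply is_derive_trig2.
    - intros; apply is_derive_trig2.
    - apply cts_trig2.
    - intros; apply trig2_periodic. }
  assert (W0 : per_int w = 0).
  { transitivity (per_int (fun t => w t * trig2 1 0 0 0 0 t)); [| apply O].
    apply per_int_ext; intros; unfold trig2; ring. }
  destruct (wirtinger_residual w w1 w2 f1 f2 cw2 r0 W0 O2) as (I1 & I2 & I3).
  assert (Ip : per_int p = 2 * PI * a0) by (unfold a0; set (i := per_int p); field; lra).
  set (s1 := a1 ^ 2 + b1 ^ 2); set (s2 := a2 ^ 2 + b2 ^ 2).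
  assert (Epp : per_int (fun t => p t ^ 2) =
    2 * PI * a0 ^ 2 + PI * s1 + PI * s2 + per_int (fun t => w t ^ 2)).
  { rewrite (per_int_ext _ (fun t => 1 * (1 * (w t ^ 2) + 2 * (w t * m t))
      + 1 * (m t * m t))) by (intros; unfold w; ring).
    rewrite !per_int_lin by cts.
    unfold m; rewrite O, per_int_trig2_mul; unfold s1, s2; ring. }
  assert (Ep2 : per_int (fun t => p t * p2 t) =
    - PI * s1 - 4 * PI * s2 + per_int (fun t => w t * w2 t)).
  { rewrite (per_int_ext _ (fun t => 1 * (1 * (w t * w2 t) + 1 * (w t * m2 t))
      + 1 * (1 * (w2 t * m t) + 1 * (m t * m2 t)))) by (intros; unfold w, w2; ring).
    rewrite !per_int_lin by cts.
    unfold m, m2; rewrite O, O2, per_int_trig2_mul; unfold s1, s2; ring. }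
  assert (E22 : per_int (fun t => p2 t ^ 2) =
    PI * s1 + 16 * PI * s2 + per_int (fun t => w2 t ^ 2)).
  { rewrite (per_int_ext _ (fun t => 1 * (1 * (w2 t ^ 2) + 2 * (w2 t * m2 t))
      + 1 * (m2 t * m2 t))) by (intros; unfold w2; ring).
    rewrite !per_int_lin by cts.
    unfold m2; rewrite O2, per_int_trig2_mul; unfold s1, s2; ring. }
  assert (EI : (per_int p) ^ 2 * 2 / PI = 8 * PI * a0 ^ 2) by (rewrite Ip; field; lra).
  rewrite EI, Epp, Ep2, E22.
  assert (0 <= PI * s2) by (unfold s2; nra).
  repeat split; [lra | lra |].
  intros e; exists a0, a1, b1, a2, b2; intros t.
  assert (w t = 0) as h by (apply I3; lra).
  unfold w in h; fold m; lra.
Qed.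

(** * Radius of curvature, length and area through the support function *)

(** The function differentiated is the component of [(x - c1, y - c2)] along the unit tangent [T],
    and [T' = - N]. The origin as base point yields [p'']; the centre of a circle yields its
    radius. *)
Lemma is_derive_normal_component (x y r : R -> R) (c1 c2 t : R) :
  (forall t, is_derive x t (r t * - sin t)) ->
  (forall t, is_derive y t (r t * cos t)) ->
  is_derive (fun u => (y u - c2) * cos u - (x u - c1) * sin u) t
    (r t - ((x t - c1) * cos t + (y t - c2) * sin t)).
Proof.
  intros hx hy; auto_derive.
  - repeat split; [exists (r t * cos t); apply hy | exists (r t * - sin t); apply hx].
  - rewrite (Derive_fun _ _ hx), (Derive_fun _ _ hy).
    pose proof (sin_pow2 t) as h; ring [h].
Qed.

(** Although [p] is only assumed differentiable once, [Derive p] is the tangential component of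
    [gamma], which inherits differentiability from the curve. *)
Lemma support_second_derivative (gamma : R -> R * R) (p r : R -> R) :
  Minkowski_support gamma p ->
  (forall theta,
     is_derive (fun t => fst (gamma t)) theta (r theta * - sin theta) /\
     is_derive (fun t => snd (gamma t)) theta (r theta * cos theta)) ->
  forall t, is_derive (Derive p) t (r t - p t).
Proof.
  intros (_ & _ & hg) hr t.
  pose proof (is_derive_normal_component _ _ r 0 0 t
    (fun u => proj1 (hr u)) (fun u => proj2 (hr u))) as D; simpl in D.
  replace (r t - p t) with
    (r t - ((fst (gamma t) - 0) * cos t + (snd (gamma t) - 0) * sin t)).
  - apply is_derive_ext with (2 := D); intros u; rewrite hg; simpl.
    pose proof (sin_pow2 u) as h; ring [h].
  - rewrite hg; simpl; pose proof (sin_pow2 t) as h; ring [h].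
Qed.

Lemma curve_length_radius (gamma : R -> R * R) (r : R -> R) :
  (forall theta, 0 < r theta) ->
  (forall theta,
     is_derive (fun t => fst (gamma t)) theta (r theta * - sin theta) /\
     is_derive (fun t => snd (gamma t)) theta (r theta * cos theta)) ->
  curve_length gamma = per_int r.
Proof.
  intros hpos hr; apply per_int_ext; intros t.
  rewrite (Derive_fun _ _ (fun u => proj1 (hr u))), (Derive_fun _ _ (fun u => proj2 (hr u))).
  replace ((r t * - sin t) ^ 2 + (r t * cos t) ^ 2) with (r t ^ 2).
  - apply sqrt_pow2; left; apply hpos.
  - pose proof (sin_pow2 t) as h; ring [h].
Qed.

(** The integrand [x dy - y dx] is [r] times the normal component of [gamma], and that component is
    [p]. *)
Lemma enclosed_area_support (gamma : R -> R * R) (p r : R -> R) :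
  Minkowski_support gamma p ->
  (forall theta,
     is_derive (fun t => fst (gamma t)) theta (r theta * - sin theta) /\
     is_derive (fun t => snd (gamma t)) theta (r theta * cos theta)) ->
  enclosed_area gamma = / 2 * per_int (fun t => p t * r t).
Proof.
  intros (_ & _ & hg) hr; unfold enclosed_area; f_equal; apply per_int_ext; intros t.
  rewrite (Derive_fun _ _ (fun u => proj1 (hr u))), (Derive_fun _ _ (fun u => proj2 (hr u))).
  rewrite hg; simpl; pose proof (sin_pow2 t) as h; ring [h].
Qed.

Lemma is_derive_constant (f : R -> R) (c t d : R) :
  (forall u, f u = c) -> is_derive f t d -> d = 0.
Proof.
  intros hf D; rewrite <- (is_derive_unique _ _ _ D), (Derive_ext _ _ t hf).
  apply Derive_const.
Qed.

(* Differentiating [|gamma - c|^2 = const] twice: first [gamma - c] is normal to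
   the curve, then its normal component is the radius of curvature. *)
Lemma circle_radius_const (gamma : R -> R * R) (r : R -> R) :
  (forall theta, 0 < r theta) ->
  (forall theta,
     is_derive (fun t => fst (gamma t)) theta (r theta * - sin theta) /\
     is_derive (fun t => snd (gamma t)) theta (r theta * cos theta)) ->
  is_circle gamma -> exists l, forall t, r t = l.
Proof.
  intros hpos hr (c1 & c2 & l & hl & hc).
  pose proof (fun u => proj1 (hr u)) as hx; pose proof (fun u => proj2 (hr u)) as hy.
  assert (N : forall t, (fst (gamma t) - c1) ^ 2 + (snd (gamma t) - c2) ^ 2 = l ^ 2)
    by (intros t; apply hc; now exists t).
  set (x := fun t => fst (gamma t)) in hx; set (y := fun t => snd (gamma t)) in hy.
  change (forall t, (x t - c1) ^ 2 + (y t - c2) ^ 2 = l ^ 2) in N.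
  assert (T : forall t, (y t - c2) * cos t - (x t - c1) * sin t = 0).
  { intros t.
    assert (D : is_derive (fun u => (x u - c1) ^ 2 + (y u - c2) ^ 2) t
      (2 * r t * ((y t - c2) * cos t - (x t - c1) * sin t))).
    { auto_derive.
      - repeat split; [exists (r t * - sin t); apply hx | exists (r t * cos t); apply hy].
      - rewrite (Derive_fun _ _ hx), (Derive_fun _ _ hy); ring. }
    apply (is_derive_constant _ _ _ _ N) in D.
    pose proof (hpos t); nra. }
  exists l; intros t.
  assert (E : r t = (x t - c1) * cos t + (y t - c2) * sin t).
  { pose proof (is_derive_normal_component x y r c1 c2 t hx hy) as D.
    apply (is_derive_constant _ _ _ _ T) in D; lra. }
  assert (Q : r t ^ 2 = l ^ 2).
  { rewrite <- (N t), E.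
    rewrite <- (Rplus_0_r (_ ^ 2)).
    replace 0 with (((y t - c2) * cos t - (x t - c1) * sin t) ^ 2)
      by (rewrite T; ring).
    pose proof (sin_pow2 t) as h; ring [h]. }
  pose proof (hpos t); nra.
Qed.

(** * The inequalities for the curve and their equality cases *)

Theorem corollary1p3 :
  forall (gamma : R -> R * R) (p rho : R -> R) (L A At : R),
    C2plus_closed_curve gamma ->
    Minkowski_support gamma p ->
    (forall theta, rho theta = curvature_radius p theta) ->
    L = curve_length gamma ->
    A = enclosed_area gamma ->
    At = evolute_area p ->
    exists M : R,
      is_max_on (fun theta => rho theta ^ 2) 0 (2 * PI) M /\
      (* the three inequalities *)
      L ^ 2 <= 4 * PI * A + PI * Rabs At /\
      RInt (fun theta => rho theta ^ 2) 0 (2 * PI)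
        >= L ^ 2 / PI - 2 * A + Rabs At /\
      M >= 1 / (2 * PI) * (L ^ 2 / PI - 2 * A + Rabs At) /\
      (* (i) and (ii) improve the known inequalities *)
      4 * PI * A + PI * Rabs At <= 4 * PI * (A + Rabs At) /\
      L ^ 2 / PI - 2 * A + Rabs At >= (L ^ 2 - 2 * PI * A) / PI /\
      (* circles are equality cases *)
      (is_circle gamma ->
         L ^ 2 = 4 * PI * A + PI * Rabs At /\
         RInt (fun theta => rho theta ^ 2) 0 (2 * PI)
           = L ^ 2 / PI - 2 * A + Rabs At /\
         M = 1 / (2 * PI) * (L ^ 2 / PI - 2 * A + Rabs At)) /\
      (* necessary form of the support function in the equality cases *)
      ((L ^ 2 = 4 * PI * A + PI * Rabs At \/
        RInt (fun theta => rho theta ^ 2) 0 (2 * PI)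
          = L ^ 2 / PI - 2 * A + Rabs At \/
        M = 1 / (2 * PI) * (L ^ 2 / PI - 2 * A + Rabs At)) ->
       exists a0 a1 b1 a2 b2 : R, forall theta,
         p theta = a0 + a1 * cos theta + b1 * sin theta
                   + a2 * cos (2 * theta) + b2 * sin (2 * theta)).
Proof.
  intros gamma p rho L A At (_ & r & cr & hpos & hr) supp hrho hL hA hAt.
  pose proof PI_RGT_0 as hpi.
  pose proof (support_second_derivative gamma p r supp hr) as d2.
  assert (d1 : forall t, is_derive p t (Derive p t))
    by (intros; apply Derive_correct, supp).
  pose proof (proj1 supp) as per0.
  pose proof (is_derive_periodic _ _ _ d1 per0) as per1.
  pose proof (cts_derive _ _ d1) as c0; pose proof (cts_derive _ _ d2) as c1.
  assert (cr' : cts r) by exact cr.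
  set (p1 := Derive p) in *;
  set (p2 := fun t => r t - p t) in *.
  assert (c2 : cts p2) by (unfold p2; cts).
  assert (rho_r : forall t, rho t = r t).
  { intros t; rewrite hrho; unfold curvature_radius; simpl.
    rewrite (Derive_fun p1 p2 d2); unfold p2; ring. }
  destruct (second_order_wirtinger p p1 p2 d1 d2 c2 per0) as (J1 & J2 & J3).
  assert (P2 : per_int p2 = 0).
  { rewrite (per_int_derive p1 p2 d2 c2).
    rewrite <- (per1 0), Rplus_0_l; ring. }
  assert (eL : L = per_int p).
  { rewrite hL, (curve_length_radius gamma r hpos hr).
    rewrite (per_int_ext r (fun t => 1 * p t + 1 * p2 t)) by (intros; unfold p2; ring).
    rewrite per_int_lin by cts; lra. }
  assert (eA : 2 * A = per_int (fun t => p t ^ 2) + per_int (fun t => p t * p2 t)).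
  { rewrite hA, (enclosed_area_support gamma p r supp hr).
    rewrite (per_int_ext (fun t => p t * r t) (fun t => 1 * p t ^ 2 + 1 * (p t * p2 t)))
      by (intros; unfold p2; ring).
    rewrite per_int_lin by cts; lra. }
  assert (eAt : 2 * At = - per_int (fun t => p t * p2 t) - per_int (fun t => p2 t ^ 2)).
  (* The periodic antiderivative [p * p1] trades the integral of [p1 ^ 2] for minus that of
     [p * p2]. *)
  { assert (Z : per_int (fun t => 1 * (p1 t ^ 2) + 1 * (p t * p2 t)) = 0).
    { rewrite (per_int_derive (fun t => p t * p1 t)).
      - rewrite <- (per0 0), <- (per1 0), Rplus_0_l; ring.
      - intros t; auto_derive.
        + repeat split; [exists (p1 t); apply d1 | exists (p2 t); apply d2].
        + rewrite (Derive_fun _ _ d1), (Derive_fun p1 p2 d2); ring.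
      - cts. }
    rewrite per_int_lin in Z by cts.
    rewrite hAt; unfold evolute_area.
    rewrite (RInt_ext _ (fun t => 1 * (p1 t ^ 2) + -1 * (p2 t ^ 2))).
    - rewrite per_int_lin by cts; lra.
    - intros t _; change (p1 t ^ 2 - Derive p1 t ^ 2 = 1 * p1 t ^ 2 + -1 * p2 t ^ 2).
      rewrite (is_derive_unique p1 t _ (d2 t)); unfold p2; ring. }
  assert (eR : per_int (fun t => rho t ^ 2) = per_int (fun t => p t ^ 2)
    + 2 * per_int (fun t => p t * p2 t) + per_int (fun t => p2 t ^ 2)).
  { rewrite (per_int_ext _ (fun t => 1 * (1 * p t ^ 2 + 2 * (p t * p2 t)) + 1 * (p2 t ^ 2)))
      by (intros; rewrite rho_r; unfold p2; ring).
    rewrite !per_int_lin by cts; lra. }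
  (* By [J1] the oriented area of the evolute is nonpositive, which resolves the absolute value. *)
  assert (aAt : Rabs At = - At) by (apply Rabs_left1; lra).
  destruct (continuity_ab_maj (fun t => rho t ^ 2) 0 (2 * PI)) as (t0 & max & ht0).
  { lra. }
  { intros t _; apply continuity_pt_filterlim.
    apply (cts_ext (fun t => r t ^ 2)); [intros; now rewrite rho_r | cts]. }
  assert (crho : cts (fun t => rho t ^ 2))
    by (apply (cts_ext (fun t => r t ^ 2)); [intros; now rewrite rho_r | cts]).
  assert (RM : per_int (fun t => rho t ^ 2) <= 2 * PI * rho t0 ^ 2).
  { rewrite <- per_int_const; apply per_int_le; [exact crho | cts | exact max]. }
  exists (rho t0 ^ 2).
  (* The centre is arbitrary, so [p] may vary; but [p + p2 = r] is the constant [l]. Hence [p * r]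
     integrates to [l * L], and [p2 * r] to 0 because [p2] has mean zero. *)
  assert (circ : is_circle gamma -> exists l, (forall t, rho t = l) /\ L = 2 * PI * l /\
    2 * A = 2 * PI * l ^ 2 /\ At = 0).
  { intros hc; destruct (circle_radius_const gamma r hpos hr hc) as (l & rl).
    assert (Ll : L = 2 * PI * l).
    { rewrite hL, (curve_length_radius gamma r hpos hr), (per_int_ext r (fun _ => l) rl).
      apply per_int_const. }
    assert (Al : per_int (fun t => p t ^ 2) + per_int (fun t => p t * p2 t) = l * L).
    { rewrite <- eA, hA, (enclosed_area_support gamma p r supp hr).
      rewrite (per_int_ext (fun t => p t * r t) (fun t => l * p t + 0 * p t))
        by (intros; rewrite rl; ring).
      rewrite per_int_lin by cts; rewrite <- eL; field. }
    assert (Bl : per_int (fun t => p t * p2 t) + per_int (fun t => p2 t ^ 2) = 0).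
    { transitivity (per_int (fun t => l * p2 t + 0 * p2 t)).
      - rewrite <- (Rmult_1_l (per_int (fun t => p t * p2 t))),
          <- (Rmult_1_l (per_int (fun t => p2 t ^ 2))), <- per_int_lin by cts.
        apply per_int_ext; intros t; unfold p2; rewrite rl; ring.
      - rewrite per_int_lin by cts; rewrite P2; ring. }
    exists l; repeat split.
    - intros t; now rewrite rho_r.
    - exact Ll.
    - rewrite eA, Al, Ll; ring.
    - lra. }
  rewrite <- eL in J2, J3.
  set (Ip := per_int (fun t => p t ^ 2)) in *.
  set (Iq := per_int (fun t => p t * p2 t)) in *.
  set (Iqq := per_int (fun t => p2 t ^ 2)) in *.
  change (RInt (fun theta : R => rho theta ^ 2) 0 (2 * PI))
    with (per_int (fun t => rho t ^ 2)).
  set (Ir := per_int (fun t => rho t ^ 2)) in *.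
  assert (defect1 : 4 * PI * A + PI * Rabs At - L ^ 2 =
    PI / 2 * (Iqq + 5 * Iq + 4 * Ip - L ^ 2 * 2 / PI)).
  { rewrite aAt; replace A with ((Ip + Iq) / 2) by lra.
    replace At with ((- Iq - Iqq) / 2) by lra; field; lra. }
  assert (defect2 : Ir - (L ^ 2 / PI - 2 * A + Rabs At) =
    / 2 * (Iqq + 5 * Iq + 4 * Ip - L ^ 2 * 2 / PI)).
  { rewrite aAt, eR, eA; replace At with ((- Iq - Iqq) / 2) by lra; field; lra. }
  set (Q := L ^ 2 / PI - 2 * A + Rabs At) in *.
  assert (MQ : 2 * PI * (1 / (2 * PI) * Q) = Q) by (field; lra).
  repeat split.
  - exists t0; split; [lra | reflexivity].
  - exact max.
  - nra.
  - lra.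
  (* The maximum dominates the mean, so (iii) follows from (ii) through [RM]. *)
  - apply Rle_ge, Rmult_le_reg_l with (2 * PI); lra.
  - pose proof (Rabs_pos At); nra.
  - replace ((L ^ 2 - 2 * PI * A) / PI) with (L ^ 2 / PI - 2 * A) by (field; lra).
    unfold Q; pose proof (Rabs_pos At); lra.
  - destruct (circ H) as (l & rl & Ll & Al & Atl).
    rewrite Atl, Rabs_R0, Ll; nra.
  - destruct (circ H) as (l & rl & Ll & Al & Atl).
    assert (Irl : Ir = 2 * PI * l ^ 2).
    { unfold Ir; rewrite <- per_int_const; apply per_int_ext; intros; now rewrite rl. }
    rewrite Irl; unfold Q; rewrite Atl, Rabs_R0, Al, Ll.
    apply Rminus_diag_uniq; field; lra.
  - destruct (circ H) as (l & rl & Ll & Al & Atl).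
    unfold Q; rewrite rl, Atl, Rabs_R0, Al, Ll; field; lra.
  - intros eq.
    apply J3.
    (* Together with [J2], the bound [Ir <= Q] forces equality. In case (iii) it comes from [RM],
       whose right-hand side is then [Q]. *)
    assert (Ir <= Q -> Iqq + 5 * Iq + 4 * Ip = L ^ 2 * 2 / PI) as key by lra.
    destruct eq as [eq | [eq | eq]].
    + rewrite eq in defect1 at 1.
      nra.
    + apply key; lra.
    + apply key; rewrite eq in RM; lra.
Qed.
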